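(* Let $w\in\mathbb R^n$ be an $L$-generic direction, let $\Lambda\in\mathfrak L_\beta$ and $I\in\mathrm{NS}(\Lambda)$. Then the following conditions are equivalent. (1) The stratum $\Lambda_I$ is $w$-bounded below. (2) The linear functional $\omega=B^{T}w$ (acting by $v\mapsto\omega\cdot v$) is nonnegative on the recession cone $R_{\Lambda,I}$. (3) The stratum $\Lambda_I$ has a unique $w$-minimum.
   Context: $[n]=\{1,\dots,n\}$. $A\in\mathrm{Mat}_{d\times n}(\mathbb Z)$ has rank $d$, $\beta\in\mathbb C^d$, $L=\mathrm{Ker}_{\mathbb Z}(A)$, $r=n-d$. $B\in\mathrm{Mat}_{n\times r}(\mathbb Z)$ is a matrix whose columns form a $\mathbb Z$-basis of $L$. An exponent lattice is a coset $\Lambda=\lambda+L$ with $\lambda\in\mathbb C^n$, $A\lambda=\beta$; $\mathfrak L_\beta$ is the set of all of them. For $\gamma\in\mathbb C^n$, $\mathrm{nsupp}(\gamma)=\{j\in[n]\mid\gamma_j\in\mathbb Z_{<0}\}$; $\Lambda_I=\{\gamma\in\Lambda\mid\mathrm{nsupp}(\gamma)=I\}$; $\mathrm{NS}(\Lambda)=\{I\subset[n]\mid\Lambda_I\ne\emptyset\}$. $E_\Lambda=\{j\in[n]\mid\lambda_j\in\mathbb Z\}$ (independent of $\lambda\in\Lambda$). The recession cone of the stratum is $R_{\Lambda,I}=\{v\in\mathbb R^r\mid(Bv)_j\le0\ (j\in I),\ (Bv)_j\ge0\ (j\in E_\Lambda\setminus I)\}$. A vector $w\in\mathbb R^n$ is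 $L$-generic if $w\cdot u\ne0$ for all $u\in L\setminus\{0\}$. On $\Lambda$, $\gamma\le_w\gamma'$ iff $w\cdot(\gamma'-\gamma)\ge0$. A nonempty $\Omega\subset\Lambda$ is $w$-bounded below if $\{w\cdot(\gamma-\lambda)\mid\gamma\in\Omega\}$ is bounded below in $\mathbb R$ for one (equivalently any) $\lambda\in\Lambda$; a $w$-minimum of $\Omega$ is an element $v\in\Omega$ with $v\le_w\gamma$ for all $\gamma\in\Omega$. *)

(* Defs.v *)
From HB Require Import structures.
From mathcomp Require Import all_boot all_order all_algebra.
From mathcomp Require Import boolp classical_sets reals.
From mathcomp.real_closed Require Import complex.
Set Implicit Arguments.
Unset Strict Implicit.
Unset Printing Implicit Defensive.
Import Order.TTheory GRing.Theory Num.Theory.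
Local Open Scope classical_set_scope.
Local Open Scope ring_scope.
Local Open Scope complex_scope.

Section ExponentLattices.
Variables (R : realType) (d n : nat).
Implicit Types (A : 'M[int]_(d, n)) (w : 'cV[R]_n).
Implicit Types (Lam Omega : set 'cV[R[i]]_n) (I : set 'I_n).

Definition intmx (K : pzRingType) p q (M : 'M[int]_(p, q)) : 'M[K]_(p, q) :=
  map_mx intr M.

Definition dot (K : pzRingType) m (x y : 'cV[K]_m) : K :=
  \sum_j x j 0 * y j 0.

Definition full_rank A : Prop := \rank (intmx rat A) = d.

Definition kerZ A : set 'cV[int]_n := [set u | A *m u = 0].

Definition Zbasis A r (B : 'M[int]_(n, r)) : Prop :=
  (forall j, kerZ A (col j B)) /\
  (forall u, kerZ A u -> exists! z : 'cV[int]_r, u = B *m z).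

(* [exponent_lattice A beta Lam] means that Lam is one of the cosets lam + L
   with A lam = beta. *)
Definition exponent_lattice A (beta : 'cV[R[i]]_d) Lam : Prop :=
  exists lam : 'cV[R[i]]_n, intmx R[i] A *m lam = beta /\
    Lam = [set lam + intmx R[i] u | u in kerZ A].

Definition nsupp (gam : 'cV[R[i]]_n) : set 'I_n :=
  [set j | exists m : int, m < 0 /\ gam j 0 = m%:~R].

Definition stratum Lam I : set 'cV[R[i]]_n :=
  [set gam | Lam gam /\ nsupp gam = I].

Definition NS Lam : set (set 'I_n) := [set I | stratum Lam I !=set0].

(* On a coset of L the choice of the representative lam is immaterial. *)
Definition Eset Lam : set 'I_n :=
  [set j | exists lam, Lam lam /\ exists m : int, lam j 0 = m%:~R].

Definition recession_cone r (B : 'M[int]_(n, r)) Lam I : set 'cV[R]_r :=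
  [set v | (forall j, I j -> (intmx R B *m v) j 0 <= 0) /\
           (forall j, (Eset Lam `\` I) j -> 0 <= (intmx R B *m v) j 0)].

Definition generic A w : Prop :=
  forall u, kerZ A u -> u != 0 -> dot w (intmx R u) != 0.

(* The pairing w . gam for a complex vector gam. The order of R[i] is partial:
   x <= y iff y - x is a nonnegative real number. Differences of elements of an
   exponent lattice are integral, so their pairings with w are real. *)
Definition cdot w (gam : 'cV[R[i]]_n) : R[i] :=
  dot (map_mx (real_complex R) w) gam.

Definition le_w w (gam gam' : 'cV[R[i]]_n) : Prop := 0 <= cdot w (gam' - gam).

Definition bounded_below w Lam Omega : Prop :=
  exists lam, Lam lam /\
    exists M : R, forall gam, Omega gam -> M%:C <= cdot w (gam - lam).

Definition w_minimum w Omega (v : 'cV[R[i]]_n) : Prop :=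
  Omega v /\ forall gam, Omega gam -> le_w w v gam.

End ExponentLattices.

(* Main.v *)
Require Import Defs.
From HB Require Import structures.
From mathcomp Require Import all_boot all_order all_algebra.
From mathcomp Require Import boolp classical_sets reals.
From mathcomp.real_closed Require Import complex.
Set Implicit Arguments.
Unset Strict Implicit.
Unset Printing Implicit Defensive.
Import Order.TTheory GRing.Theory Num.Theory.
Local Open Scope classical_set_scope.
Local Open Scope ring_scope.
Local Open Scope complex_scope.

(** Everything rests on one consequence of Dickson's lemma: a function that is
monotone for a vector of finitely many natural-number parameters attains its
minimum on every nonempty set ([dickson_attains_min]).

Fix gam0 in the stratum and write the lattice Lam as gam0 + B z, with z an
integer vector.  On the stratum each integral coordinate has a fixed sign,
so it is determined by its absolute value, a natural number.  If these
absolute values are coordinatewise at most as large at z as at z', then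
z' - z lies in the recession cone.

If omega = B^T w is nonnegative on the recession cone, then omega . z is
therefore monotone in the absolute values, hence attains its minimum on the
stratum.  Genericity of w makes the minimum unique, two minima differing by an
element of L orthogonal to w ([stratum_unique_min]).

If the stratum is w-bounded below, then omega is nonnegative on the integer
points z of the recession cone, because the ray gam0 + k B z stays in the
stratum ([bounded_lattice_directions]).  To pass to a real point v of the cone,
let z_k be the integer vector obtained by rounding k v.  The coordinates of
B z_k violate the inequalities of the cone by at most a constant C independent
of k, so after a shift by C they are natural numbers.  If these numbers grow
from k to l, then z_l - z_k is an integer point of the cone, where omega is
already known to be nonnegative.  So omega . z_k is bounded below over all k; it
differs from k (omega . v) by a bounded amount, whence omega . v >= 0
([bounded_recession_cone]).

A w-minimum is itself a lower bound, which closes the circle. *)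

(** * Minima of monotone functions of natural-number vectors *)

Section Dickson.
Variables (T : Type) (disp : Order.disp_t) (V : orderType disp) (g : T -> V).

Definition attains_min (S : set T) : Prop :=
  exists2 x, S x & forall y, S y -> (g x <= g y)%O.

(** Some members of the cover may be empty, which is why the hypothesis only
concerns the nonempty ones. *)
Lemma attains_min_finite_cover (P : eqType) (s : seq P) (S : P -> set T) :
  (forall p, S p !=set0 -> attains_min (S p)) ->
  forall U : set T, U !=set0 ->
  (forall y, U y <-> exists2 p, p \in s & S p y) -> attains_min U.
Proof.
move=> minS; elim: s => [|p s IHs] U [y0 Uy0] coverU.
  by have [p] := (coverU y0).1 Uy0; rewrite in_nil.
pose U' : set T := [set y | exists2 p, p \in s & S p y].
have subU' y : U' y -> U y.
  by case=> q qs Sqy; apply/coverU; exists q; rewrite ?inE ?qs ?orbT.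
have subSp y : S p y -> U y.
  by move=> Spy; apply/coverU; exists p; rewrite ?inE ?eqxx.
have splitU y : U y -> S p y \/ U' y.
  move=> /coverU[q]; rewrite inE => /predU1P[-> | qs]; first by left.
  by right; exists q.
have [Sp_ne|Sp0] := pselect (S p !=set0); last first.
  have U'_ne : U' !=set0.
    by exists y0; case: (splitU _ Uy0) => // Spy; case: Sp0; exists y0.
  have [x U'x xmin] := IHs U' U'_ne (fun=> iff_refl _).
  exists x; first exact: subU'.
  by move=> y /splitU[Spy|]; [case: Sp0; exists y | exact: xmin].
have [x Spx xmin] := minS p Sp_ne.
have [U'_ne|U'0] := pselect (U' !=set0); last first.
  exists x; first exact: subSp.
  by move=> y /splitU[/xmin//|U'y]; case: U'0; exists y.
have [x' U'x' x'min] := IHs U' U'_ne (fun=> iff_refl _).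
have [le_xx'|lt_x'x] := leP (g x) (g x').
  exists x => [|y /splitU[/xmin//|/x'min]]; first exact: subSp.
  exact: le_trans.
exists x' => [|y /splitU[/xmin|/x'min//]]; first exact: subU'.
exact/le_trans/ltW.
Qed.

Variables (J : finType) (f : T -> J -> nat).

(** The proof of Dickson's lemma, by induction on the number of parameters:
given x0 in S, a point of S either dominates x0, and then x0 does at least as
well, or has a parameter i with value v < f x0 i.  There are finitely many such
pairs (i, v), and on each corresponding piece the parameter i is constant and
may be dropped. *)
Lemma dickson_attains_min (D : {set J}) (S : set T) : S !=set0 ->
  (forall x y, S x -> S y -> (forall j, j \in D -> (f x j <= f y j)%N) ->
     (g x <= g y)%O) ->
  attains_min S.
Proof.
have [m] := ubnP #|D|; elim: m => // m IHm in D S *.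
rewrite ltnS => leDm [x0 Sx0] g_mono.
pose piece (p : option (J * nat)) : set T :=
  if p is Some (i, v) then [set y | [/\ S y, i \in D & f y i = v]]
  else [set y | S y /\ forall j, j \in D -> (f x0 j <= f y j)%N].
pose s := None :: [seq Some (i, v) | i <- enum J, v <- iota 0 (f x0 i)].
apply: (@attains_min_finite_cover _ s piece); last 1 first.
- move=> y; split=> [Sy|[[[i v]|] _ []//]].
  have [ge_x0|] := pselect (forall j, j \in D -> (f x0 j <= f y j)%N).
    by exists None; rewrite ?mem_head.
  move=> /existsNP[i /not_implyP[Di /negP]]; rewrite -ltnNge => lt_yx0.
  exists (Some (i, f y i)); last by split.
  rewrite inE /=; apply/allpairsPdep; exists i, (f y i).
  by rewrite mem_enum mem_iota.
- case=> [[i v]|] [y0]; last by case=> *; exists x0 => // y [Sy /g_mono]; apply.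
  case=> Sy0 Di _y0; apply: (IHm (D :\ i)); last first.
  + move=> x y [Sx _ fx] [Sy _ fy] le_xy; apply: g_mono => // j Dj.
    have [->|neq_ji] := eqVneq j i; first by rewrite fx fy.
    by apply: le_xy; rewrite !inE neq_ji.
  + by exists y0; split.
  + by move: leDm; rewrite (cardsD1 i) Di.
- by exists x0.
Qed.

End Dickson.

(** * The pairing with integral and real vectors *)

Section Pairing.

Lemma dotE (K : pzRingType) m (x y : 'cV[K]_m) : dot x y = (x^T *m y) 0 0.
Proof. by rewrite mxE; apply: eq_bigr => j _; rewrite mxE. Qed.

Lemma dot_trmx (K : comPzRingType) m p (M : 'M[K]_(m, p)) x y :
  dot (M^T *m x) y = dot x (M *m y).
Proof. by rewrite !dotE trmx_mul trmxK mulmxA. Qed.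

Lemma dotD (K : pzRingType) m (x y z : 'cV[K]_m) :
  dot x (y + z) = dot x y + dot x z.
Proof. by rewrite !dotE mulmxDr mxE. Qed.

Lemma dotN (K : pzRingType) m (x y : 'cV[K]_m) : dot x (- y) = - dot x y.
Proof. by rewrite !dotE mulmxN mxE. Qed.

Lemma dotZ (K : comPzRingType) m a (x y : 'cV[K]_m) :
  dot x (a *: y) = a * dot x y.
Proof. by rewrite !dotE -scalemxAr mxE. Qed.

Lemma intmxM (K : pzRingType) m p q (M : 'M[int]_(m, p)) (N : 'M_(p, q)) :
  intmx K (M *m N) = intmx K M *m intmx K N.
Proof. exact: map_mxM. Qed.

Lemma intmxD (K : pzRingType) p q (M N : 'M[int]_(p, q)) :
  intmx K (M + N) = intmx K M + intmx K N.
Proof. exact: map_mxD. Qed.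

Lemma intmxB (K : pzRingType) p q (M N : 'M[int]_(p, q)) :
  intmx K (M - N) = intmx K M - intmx K N.
Proof. exact: map_mxB. Qed.

(** Brings the order of the complex field back to that of the reals: differences
of points of an exponent lattice are integral, so their pairing with w is
real. *)
Lemma cdot_intmx (R : realType) n (w : 'cV[R]_n) (u : 'cV[int]_n) :
  cdot w (intmx R[i] u) = (dot w (intmx R u))%:C.
Proof.
rewrite /cdot /dot (rmorph_sum (real_complex R)); apply: eq_bigr => j _.
by rewrite !mxE rmorphM /= rmorph_int.
Qed.

Lemma le_dot_sum_norm (R : realType) m (x e : 'cV[R]_m) :
  (forall j, `|e j 0| <= 1) -> `|dot x e| <= \sum_j `|x j 0|.
Proof.
move=> e_le1; apply: le_trans (ler_norm_sum _ _ _) _.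
by apply: ler_sum => j _; rewrite normrM ler_piMr.
Qed.

(** Archimedean property: a line with negative slope is unbounded below along
the natural numbers. *)
Lemma slope_ge0 (R : realType) (a b t : R) :
  (forall k : nat, a <= b + k%:R * t) -> 0 <= t.
Proof.
move=> le_line; rewrite leNgt; apply/negP => t_lt0.
have /archi_boundP : 0 <= `|(b - a) / t| by [].
set k := Num.bound _ => lt_k.
have := le_line k; apply/negP; rewrite -ltNge -ltrBrDl.
rewrite -ltr_ndivrMr // (le_lt_trans _ lt_k) //.
by rewrite -opprB mulNr (le_trans (ler_norm _)) ?normrN.
Qed.

End Pairing.

(** * Strata and their recession cones *)

Section Strata.
Variables (R : realType) (d n r : nat) (A : 'M[int]_(d, n)).
Variables (beta : 'cV[R[i]]_d) (B : 'M[int]_(n, r)) (hB : Zbasis A B).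
Variables (w : 'cV[R]_n) (hw : generic A w).
Variables (Lam : set 'cV[R[i]]_n) (hLam : exponent_lattice A beta Lam).
Variables (I : set 'I_n) (gam0 : 'cV[R[i]]_n) (hgam0 : stratum Lam I gam0).

Let translate (c : 'cV[int]_n) := gam0 + intmx R[i] c.

Lemma kerZ_range z : kerZ A (B *m z).
Proof.
rewrite /kerZ /= mulmxA; suff -> : A *m B = 0 by rewrite mul0mx.
apply/matrixP=> i j; have /colP/(_ i) := hB.1 j.
by rewrite colE mulmxA -colE [col _ _ _ _]mxE => ->; rewrite !mxE.
Qed.

Lemma lattice_diff gam lam : Lam gam -> Lam lam ->
  exists2 u, kerZ A u & gam = lam + intmx R[i] u.
Proof.
have [mu [_ ->]] := hLam => -[u hu <-] [v hv <-].
exists (u - v); first by rewrite /kerZ /= mulmxBr hu hv subrr.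
by rewrite intmxB -addrA (addrC (intmx _ v)) subrK.
Qed.

Lemma lattice_translate gam u : Lam gam -> kerZ A u ->
  Lam (gam + intmx R[i] u).
Proof.
have [mu [_ ->]] := hLam => -[v hv <-] hu.
exists (v + u); first by rewrite /kerZ /= mulmxDr hu hv addr0.
by rewrite intmxD addrA.
Qed.

Lemma lattice_param gam : Lam gam -> exists z, gam = translate (B *m z).
Proof.
case/lattice_diff/(_ hgam0.1) => u /(proj2 hB)[z [-> _]] ->.
by exists z.
Qed.

Lemma Eset_int j gam : Lam gam -> Eset Lam j -> exists m : int, gam j 0 = m%:~R.
Proof.
move=> hgam [lam [hlam [m hm]]]; have [u _ ->] := lattice_diff hgam hlam.
by exists (m + u j 0); rewrite !mxE hm intrD.
Qed.

Lemma stratum_sub_Eset : I `<=` Eset Lam.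
Proof.
case: hgam0 => hgam <- j [m [_ hm]]; exists gam0; by split=> //; exists m.
Qed.

(** Collects the integral coordinates of gam0 into an integer vector, whose
entries outside Eset are arbitrary; sign conditions on the lattice then become
inequalities between integers. *)
Lemma integral_coordinates : exists a : 'cV[int]_n,
  forall j, Eset Lam j -> gam0 j 0 = (a j 0)%:~R.
Proof.
have /choice[a aE] j : exists m : int, Eset Lam j -> gam0 j 0 = m%:~R.
  have [Ej|nEj] := pselect (Eset Lam j); last by exists 0.
  by have [m] := Eset_int hgam0.1 Ej; exists m.
by exists (\col_j a j) => j; rewrite mxE; apply: aE.
Qed.

Variables (a : 'cV[int]_n).
Hypothesis aE : forall j, Eset Lam j -> gam0 j 0 = (a j 0)%:~R.

(** A coordinate outside Eset is integral at no point of the lattice, so it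
never enters a negative support. *)
Lemma nsupp_translate c j : kerZ A c ->
  nsupp (translate c) j <-> Eset Lam j /\ a j 0 + c j 0 < 0.
Proof.
move=> hc; split=> [[m [m_lt0 hm]]|[Ej lt0]]; last first.
  by exists (a j 0 + c j 0); split=> //; rewrite !mxE aE // intrD.
have Ej : Eset Lam j.
  exists (translate c); split; last by exists m.
  exact: lattice_translate hgam0.1 hc.
by split=> //; move: hm; rewrite !mxE aE // -intrD => /intr_inj ->.
Qed.

Lemma nsupp_sign j : I j <-> Eset Lam j /\ a j 0 < 0.
Proof.
have := @nsupp_translate 0 j; rewrite /translate /intmx map_mx0 addr0 hgam0.2.
by rewrite mxE addr0; apply; rewrite /kerZ /= mulmx0.
Qed.

(** The sign that coordinate j has on the stratum; it merges the two families
of inequalities of the recession cone into one. *)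
Definition stratum_sign j : int := if `[< I j >] then -1 else 1.

Lemma recession_coneP v : recession_cone B Lam I v <->
  forall j, Eset Lam j -> 0 <= (stratum_sign j)%:~R * (intmx R B *m v) j 0.
Proof.
rewrite /stratum_sign; split=> [[le0 ge0] j Ej|pos].
  case: asboolP => Ij; rewrite ?rmorphN1 ?mulN1r ?oppr_ge0 ?mul1r.
    exact: le0.
  exact: ge0.
split=> j => [Ij|[Ej nIj]].
  have := pos _ (stratum_sub_Eset Ij).
  by rewrite asboolT // rmorphN1 mulN1r oppr_ge0.
by have := pos _ Ej; rewrite asboolF // mul1r.
Qed.

Lemma recession_cone_int z : recession_cone B Lam I (intmx R z) <->
  forall j, Eset Lam j -> 0 <= stratum_sign j * (B *m z) j 0.
Proof.
rewrite recession_coneP -intmxM; split=> pos j /pos; rewrite [intmx _ _ _ _]mxE;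
  by rewrite -intrM ler0z.
Qed.

Lemma stratum_translateP z : stratum Lam I (translate (B *m z)) <->
  forall j, Eset Lam j -> (I j <-> (a + B *m z) j 0 < 0).
Proof.
have hc := kerZ_range z; split=> [[_ <-] j Ej|I_lt0].
  by rewrite nsupp_translate // [(a + _) j 0]mxE; tauto.
split; first exact: lattice_translate hgam0.1 hc.
apply/seteqP; split=> j.
  move=> /(nsupp_translate _ hc)[Ej]; have := I_lt0 j Ej.
  by rewrite [(a + _) j 0]mxE; tauto.
move=> Ij; have Ej := stratum_sub_Eset Ij.
apply/(nsupp_translate _ hc); split=> //; have := I_lt0 j Ej.
by rewrite [(a + _) j 0]mxE; tauto.
Qed.

(** The coordinates have a fixed sign on the stratum, so there the order of
their absolute values compares points modulo the recession cone. *)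
Lemma stratum_norm z j : stratum Lam I (translate (B *m z)) -> Eset Lam j ->
  (`|((a + B *m z) j 0)%R|%N : int) = stratum_sign j * (a + B *m z) j 0.
Proof.
move=> /stratum_translateP/[apply]; rewrite /stratum_sign abszE.
case: asboolP => Ij lt0P.
  by rewrite ltr0_norm ?mulN1r //; tauto.
by rewrite mul1r ger0_norm // leNgt; apply/negP; tauto.
Qed.

(** Moving along an integer direction of the recession cone never brings an
integral coordinate closer to the wall between -1 and 0. *)
Lemma stratum_ray z k : recession_cone B Lam I (intmx R z) ->
  stratum Lam I (translate (B *m (z *+ k))).
Proof.
move=> /recession_cone_int pos; apply/stratum_translateP => j Ej.
have [IE EI] := nsupp_sign j; have := pos j Ej.
rewrite raddfMn [(a + _) j 0]mxE mulmxnE /stratum_sign; case: asboolP => Ij.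
  rewrite mulN1r oppr_ge0 => le0; split=> // _.
  by rewrite -[ltRHS]addr0 ltr_leD ?mulrn_wle0 //; case: (IE Ij).
rewrite mul1r => ge0; split=> // lt0; apply: EI; split=> //.
by apply: le_lt_trans lt0; rewrite lerDl mulrn_wge0.
Qed.

Let om (v : 'cV[R]_r) : R := dot ((intmx R B)^T *m w) v.

Lemma cdot_translateB z z' :
  cdot w (translate (B *m z) - translate (B *m z')) =
  (om (intmx R z) - om (intmx R z'))%:C.
Proof.
rewrite /translate opprD addrACA subrr add0r -intmxB cdot_intmx /om.
by rewrite !dot_trmx -!intmxM intmxB dotD dotN.
Qed.

(** Along the ray gam0 + k B z, which stays in the stratum, the w-value changes
by k (omega . z), so a lower bound forces omega . z >= 0. *)
Lemma bounded_lattice_directions : bounded_below w Lam (stratum Lam I) ->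
  forall z, recession_cone B Lam I (intmx R z) -> 0 <= om (intmx R z).
Proof.
case=> lam [hlam [M ge_M]] z /stratum_ray ray.
have [z0 lamE] := lattice_param hlam.
apply: (@slope_ge0 _ M (- om (intmx R z0))) => k.
have := ge_M _ (ray k); rewrite lamE cdot_translateB lecR addrC.
suff -> : om (intmx R (z *+ k)) = k%:R * om (intmx R z) by [].
by rewrite /om -dotZ /intmx raddfMn /= scaler_nat.
Qed.

(** The directions z_k = floor (k v) stay at bounded distance from k v, hence
within a constant of the cone; the Dickson argument turns this approximate
membership into exact membership of differences z_l - z_k. *)
Lemma bounded_recession_cone : bounded_below w Lam (stratum Lam I) ->
  forall v, recession_cone B Lam I v -> 0 <= om v.
Proof.
move=> /bounded_lattice_directions om_ge0 v /recession_coneP v_pos.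
pose z k : 'cV[int]_r := \col_l Num.floor (k%:R * v l 0).
pose e k : 'cV[R]_r := intmx R (z k) - k%:R *: v.
have e_le1 k l : `|e k l 0| <= 1.
  rewrite !mxE ler_norml; have := floor_itv (k%:R * v l 0).
  rewrite intrD => /andP[fl fr]; apply/andP; split.
    by rewrite lerBrDl lerBlDr ltW.
  by rewrite lerBlDr (le_trans fl) // lerDr.
(* Rounding errors are at most 1, so C j bounds the error on coordinate j. *)
pose C j : int := \sum_l `|B j l|.
have err k j : `|(intmx R B *m e k) j 0| <= (C j)%:~R.
  have -> : (intmx R B *m e k) j 0 = dot (row j (intmx R B))^T (e k).
    by rewrite dotE trmxK -row_mul [RHS]mxE.
  apply: le_trans (le_dot_sum_norm _ (e_le1 k)) _.
  by rewrite /C rmorph_sum /=; apply: ler_sum => l _; rewrite !mxE intr_norm.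
have zE k : intmx R (z k) = k%:R *: v + e k by rewrite addrC subrK.
have norm_sign (x : R) j : `|(stratum_sign j)%:~R * x| = `|x|.
  by rewrite normrM /stratum_sign; case: asboolP => _; rewrite ?normrN1 ?normr1 mul1r.
have shift_ge0 k j : Eset Lam j -> 0 <= C j + stratum_sign j * (B *m z k) j 0.
  move=> Ej; rewrite -(ler0z R) intrD intrM.
  have -> : ((B *m z k) j 0)%:~R =
      k%:R * (intmx R B *m v) j 0 + (intmx R B *m e k) j 0.
    have -> : ((B *m z k) j 0)%:~R = intmx R (B *m z k) j 0 by rewrite [RHS]mxE.
    by rewrite intmxM zE mulmxDr -scalemxAr [LHS]mxE [X in X + _]mxE.
  rewrite mulrDr addrCA; apply: addr_ge0; first by rewrite mulrCA mulr_ge0 ?v_pos.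
  rewrite -lerBlDl sub0r; have := err k j; rewrite -(norm_sign _ j).
  by rewrite ler_norml => /andP[].
(* By shift_ge0 the absolute value loses nothing on Eset. *)
pose f k j : nat := `|(C j + stratum_sign j * (B *m z k) j 0)%R|%N.
have [k0 _ k0_min] : attains_min (fun k => om (intmx R (z k))) setT.
  apply: (@dickson_attains_min _ _ _ _ _ f [set j | `[< Eset Lam j >]]%SET).
    by exists 0%N.
  move=> k l _ _ le_kl; rewrite -subr_ge0 /om -dotN -dotD -intmxB.
  apply/om_ge0/recession_cone_int => j Ej.
  have : (f k j <= f l j)%N by apply: le_kl; rewrite inE; apply/asboolP.
  rewrite -lez_nat /f !abszE !ger0_norm ?shift_ge0 // lerD2l => le_sg.
  by rewrite mulmxBr [X in _ * X]mxE [X in _ + X]mxE mulrBr subr_ge0.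
(* om (z k0) <= om (z k) <= k * om v + (sum of the norms of the entries of
   omega), for every k. *)
apply: (@slope_ge0 _ (om (intmx R (z k0)))
         (\sum_l `|((intmx R B)^T *m w) l 0|)) => k.
apply: le_trans (k0_min k Logic.I) _.
rewrite zE /om dotD dotZ addrC lerD2r.
exact: le_trans (ler_norm _) (le_dot_sum_norm _ (e_le1 k)).
Qed.

Lemma stratum_unique_min : (forall v, recession_cone B Lam I v -> 0 <= om v) ->
  exists! v, w_minimum w (stratum Lam I) v.
Proof.
move=> om_ge0.
pose S : set 'cV[int]_r := [set z | stratum Lam I (translate (B *m z))].
pose f (z : 'cV[int]_r) j : nat := `|((a + B *m z) j 0)%R|%N.
have [z0 Sz0 z0_min] : attains_min (fun z => om (intmx R z)) S.
  apply: (@dickson_attains_min _ _ _ _ _ f [set j | `[< Eset Lam j >]]%SET).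
    by exists 0; rewrite /S /= mulmx0 /translate /intmx map_mx0 addr0.
  move=> z z' Sz Sz' le_zz'; rewrite -subr_ge0 /om -dotN -dotD -intmxB.
  apply/om_ge0/recession_cone_int => j Ej.
  have : (f z j <= f z' j)%N by apply: le_zz'; rewrite inE; apply/asboolP.
  rewrite -lez_nat /f !stratum_norm //.
  by rewrite mulmxBr !mxE -subr_ge0 -mulrBr opprD addrACA subrr add0r.
exists (translate (B *m z0)); split.
  split=> // gam hgam; have [z gamE] := lattice_param hgam.1.
  rewrite /le_w gamE cdot_translateB lecR subr_ge0; apply: z0_min.
  by rewrite /S /= -gamE.
move=> gam [hgam gam_min]; have [z gamE] := lattice_param hgam.1.
have := gam_min _ Sz0; rewrite gamE /le_w cdot_translateB lecR subr_ge0 => ge_z.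
have /eqP : om (intmx R z0) = om (intmx R z).
  by apply/le_anti; rewrite ge_z z0_min // /S /= -gamE.
rewrite -subr_eq0 /om !dot_trmx -dotN -dotD -!intmxM -intmxB -mulmxBr.
have [/eqP|nz] := eqVneq (B *m (z0 - z)) 0; last first.
  by rewrite (negPf (hw (kerZ_range _) nz)).
by rewrite mulmxBr subr_eq0 => /eqP ->.
Qed.

End Strata.

Lemma minimum_bounded_below (R : realType) n (w : 'cV[R]_n) Lam I v :
  w_minimum w (stratum Lam I) v -> bounded_below w Lam (stratum Lam I).
Proof. by case=> -[hv _] vmin; exists v; split=> //; exists 0 => gam /vmin. Qed.

Theorem proposition2p3 (R : realType) (d n : nat) (A : 'M[int]_(d, n))
  (hA : full_rank A) (beta : 'cV[R[i]]_d)
  (B : 'M[int]_(n, n - d)) (hB : Zbasis A B)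
  (w : 'cV[R]_n) (hw : generic A w)
  (Lam : set 'cV[R[i]]_n) (hLam : exponent_lattice A beta Lam)
  (I : set 'I_n) (hI : NS Lam I) :
  [<-> bounded_below w Lam (stratum Lam I);
       forall v : 'cV[R]_(n - d), recession_cone B Lam I v ->
         0 <= dot ((intmx R B)^T *m w) v;
       exists! v : 'cV[R[i]]_n, w_minimum w (stratum Lam I) v].
Proof.
case: hI => gam0 hgam0; have [a aE] := integral_coordinates hLam hgam0; tfae.
- exact: (bounded_recession_cone hB hLam hgam0 aE).
- exact: (stratum_unique_min hB hw hLam hgam0 aE).
- by case=> v [/minimum_bounded_below].
Qed.
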